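(* Every finitely generated polynomial semigroup has a unique minimal generating set.
   Context: Let $\widehat{\mathbb{C}}$ be the Riemann sphere. A rational semigroup is a subsemigroup (with respect to composition) of the semigroup of holomorphic self-maps of $\widehat{\mathbb{C}}$ that contains no constant maps. A rational semigroup $S$ is called a polynomial semigroup if all its elements are polynomials, any degree-one element of $S$ has an attracting fixed point at $\infty$ (i.e., is of the form $z\mapsto az+b$ with $|a|>1$), and $S$ contains at least one element of degree at least $2$. A set $\mathcal{G}$ is a set of generators (generating set) of $S$, written $S=\langle g: g\in\mathcal{G}\rangle$, if $\mathcal{G}\subseteq S$ and every element of $S$ is a composition $f_{n}\circ\dots\circ f_{1}$, $n\geq 1$, of elements of $\mathcal{G}$ (repetitions allowed). $S$ is finitely generated if it has a finite set of generators. A (finite) set of generators $\mathcal{G}=\{g_1,\dots,g_N\}$ of $S$ is called minimal if no function $g_i$ can be expressed as a composition of elements (with repetitions allowed) of the set of the remaining generators $\mathcal{G}\setminus\{g_i\}$. *)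

(* Defs.v *)
From HB Require Import structures.
From mathcomp Require Import all_boot all_order all_algebra.
From mathcomp Require Import complex.
From mathcomp Require Import all_classical all_reals all_analysis.
Set Implicit Arguments.
Unset Strict Implicit.
Unset Printing Implicit Defensive.
Import Order.TTheory GRing.Theory Num.Theory.
Import numFieldNormedType.Exports.
Local Open Scope classical_set_scope.
Local Open Scope ring_scope.

(* The complex numbers, carrying the topology given by the modulus. *)
Definition cplx (R : realType) : numFieldType := R[i].

(* [Some z] is the finite point z and [None] is the point at infinity. *)
Definition sphere (R : realType) : topologicalType :=
  one_point_compactification (cplx R).

(* The involution z |-> 1/z, exchanging 0 and infinity. *)
Definition sphere_inv (R : realType) (x : sphere R) : sphere R :=
  if x is Some z then (if z == 0 then None else Some z^-1) else Some 0.

(* Two charts: the identity around finite points, and 1/z around infinity.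
   [chart x] is the coordinate used near x; it takes the junk value 0 at the
   single point outside the domain of the chart.  [cochart x] is its inverse. *)
Definition chart (R : realType) (x y : sphere R) : cplx R :=
  odflt 0 (if x is Some _ then y else sphere_inv y).

Definition cochart (R : realType) (x : sphere R) (t : cplx R) : sphere R :=
  if x is Some _ then Some t else sphere_inv (Some t).

(* Continuity guarantees that f maps a neighbourhood of x into the domain of
   the chart at f x, so the junk value plays no role in the derivative. *)
Definition holomorphic (R : realType) (f : sphere R -> sphere R) : Prop :=
  continuous f /\
  forall x, derivable (chart (f x) \o f \o cochart x) (chart x x) 1.

Definition constant_map (R : realType) (f : sphere R -> sphere R) : Prop :=
  exists c, forall x, f x = c.

Definition rational_semigroup (R : realType)
    (S : set (sphere R -> sphere R)) : Prop :=
  [/\ forall f, S f -> holomorphic f,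
      forall f, S f -> ~ constant_map f
    & forall f g, S f -> S g -> S (f \o g)].

(* A nonconstant polynomial fixes infinity. *)
Definition poly_map (R : realType) (p : {poly cplx R}) (x : sphere R) :
    sphere R :=
  match x with
  | Some z => Some p.[z]
  | None => if (1 < size p)%N then None else Some p`_0
  end.

(* Degree d corresponds to [size p = d.+1]. *)
Definition polynomial_semigroup (R : realType)
    (S : set (sphere R -> sphere R)) : Prop :=
  [/\ rational_semigroup S,
      forall f, S f -> exists p, f = poly_map p,
      forall p, S (poly_map p) -> size p = 2 ->
        exists a b : cplx R, p = a *: 'X + b%:P /\ 1 < `|a|
    & exists2 p, S (poly_map p) & (3 <= size p)%N].

(* All the maps f_n \o ... \o f_1 with n >= 1 and every f_i in G. *)
Inductive composition_of (T : Type) (G : set (T -> T)) : set (T -> T) :=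
| composition_one f : G f -> composition_of G f
| composition_cons f h :
    G f -> composition_of G h -> composition_of G (f \o h).

Definition generating_set (T : Type) (S G : set (T -> T)) : Prop :=
  G `<=` S /\ S `<=` composition_of G.

Definition finitely_generated (T : Type) (S : set (T -> T)) : Prop :=
  exists2 G, finite_set G & generating_set S G.

Definition minimal_generating_set (T : Type) (S G : set (T -> T)) : Prop :=
  [/\ finite_set G, generating_set S G
    & forall g, G g -> ~ composition_of (G `\ g) g].

(* Main.v *)
(** Composing two elements of a polynomial semigroup strictly increases the
    pair (degree, modulus of the leading coefficient), ordered
    lexicographically, with respect to both factors: degrees multiply, and a
    factor z |-> az + b leaves the degree of the other factor unchanged while
    multiplying the modulus of its leading coefficient by a positive power of
    |a| > 1.  Hence if g = u o v, no word representing u or v contains g, so a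
    generator of a minimal generating set is never a proper product, and it
    therefore belongs to every other generating set.  A finite generating set of
    least cardinality is minimal. *)
Require Import Defs.
From mathcomp Require Import all_boot all_order all_algebra.
From mathcomp Require Import complex finmap.
From mathcomp Require Import all_classical all_reals all_analysis.

Set Implicit Arguments.
Unset Strict Implicit.
Unset Printing Implicit Defensive.
Import Order.TTheory GRing.Theory Num.Theory.
Import numFieldNormedType.Exports.
Local Open Scope classical_set_scope.
Local Open Scope ring_scope.

Section Compositions.
Variable T : Type.
Implicit Types (f g h : T -> T) (S G : set (T -> T)).

Lemma composition_of_comp G f h :
  composition_of G f -> composition_of G h -> composition_of G (f \o h).
Proof.
elim=> [{}f Gf|f' h' Gf' _ IH] Hh; first exact: composition_cons.
by apply: (@composition_cons _ _ f' (h' \o h)) => //; exact: IH.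
Qed.

Lemma composition_of_trans G G' f :
  G `<=` composition_of G' -> composition_of G f -> composition_of G' f.
Proof.
move=> GG'; elim=> [{}f /GG'//|f' h /GG' Gf' _ IH].
exact: composition_of_comp.
Qed.

Lemma composition_of_closed S G f :
  (forall f h, S f -> S h -> S (f \o h)) -> G `<=` S ->
  composition_of G f -> S f.
Proof.
by move=> Scomp GS; elim=> [{}f /GS//|f' h /GS Sf' _]; exact: Scomp.
Qed.

Lemma ex_minimal_generating_set S :
  finitely_generated S -> exists G, minimal_generating_set S G.
Proof.
(* The alias [{classic T -> T}] gives functions the classical choice structure that finite sets
   require. *)
pose card (G : set (T -> T)) := #|` fset_set (G : set {classic T -> T})|%fset.
case=> G; have [n] := ubnP (card G); elim: n G => // n IH G Gn finG genG.
have [[g Gg gG]|minG] := pselect (exists2 g, G g & composition_of (G `\ g) g);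
  last by exists G; split => // g Gg gG; apply: minG; exists g.
have finG' : finite_set (G `\ g) by exact: finite_setD.
apply: (IH (G `\ g)) => //.
  rewrite /card (@fset_setD1 {classic T -> T})//.
  move: Gn; rewrite /card (cardfsD1 (g : {classic T -> T})).
  rewrite (@in_fset_set {classic T -> T})//.
  by rewrite mem_set.
split.
  by move=> f [/genG.1].
(* Each occurrence of [g] in a word is replaced by its expression [gG] in the other generators. *)
move=> f /genG.2; apply: composition_of_trans => f' Gf'.
have [->//|f'g] := pselect (f' = g).
by apply: composition_one; split.
Qed.

Section Uniqueness.
Variables (S : set (T -> T)) (lt : (T -> T) -> (T -> T) -> Prop).
Hypothesis Scomp : forall f h, S f -> S h -> S (f \o h).
Hypothesis lt_irr : forall f, ~ lt f f.
Hypothesis lt_trans : forall f g h, lt f g -> lt g h -> lt f h.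
Hypothesis lt_compl : forall f h, S f -> S h -> lt f (f \o h).
Hypothesis lt_compr : forall f h, S f -> S h -> lt h (f \o h).

(** A word that contains [g] is either [g] alone or has [g] as a proper factor, and each further
    composition only moves up in [lt]. *)
Lemma composition_of_setD1 G f g : G `<=` S -> composition_of G f ->
  [\/ composition_of (G `\ g) f, g = f | lt g f].
Proof.
move=> GS; elim=> [{}f Gf|f' h Gf' Gh IH].
  have [->|fg] := pselect (f = g); first exact: Or32.
  by apply: Or31; apply: composition_one; split.
have Sf' := GS _ Gf'; have Sh := composition_of_closed Scomp GS Gh.
have [<-|f'g] := pselect (f' = g); first exact/Or33/lt_compl.
case: IH => [Gh'|->|gh].
- by apply: Or31; apply: composition_cons.
- exact/Or33/lt_compr.
- exact/Or33/(lt_trans gh)/lt_compr.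
Qed.

Lemma composition_of_lt G f g : generating_set S G -> S f -> lt f g ->
  composition_of (G `\ g) f.
Proof.
move=> [GS SG] /SG Gf fg.
have [//|gf|gf] := composition_of_setD1 g GS Gf.
- by case: (@lt_irr g); rewrite {1}gf.
- by case: (lt_irr (lt_trans fg gf)).
Qed.

Lemma minimal_generating_set_sub G G' :
  minimal_generating_set S G -> generating_set S G' -> G `<=` G'.
Proof.
move=> [_ genG minG] [G'S SG'] g Gg.
have G'g := SG' _ (genG.1 _ Gg).
(* A word of length one puts [g] in [G']. A longer one splits [g] into two factors below it, both
   expressible in [G] without [g], against minimality. *)
case: G'g Gg => // f h G'f G'h Gfh.
have Sf := G'S _ G'f; have Sh := composition_of_closed Scomp G'S G'h.
case: (minG _ Gfh); apply: composition_of_comp.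
- exact/composition_of_lt/lt_compl.
- exact/composition_of_lt/lt_compr.
Qed.

Lemma minimal_generating_set_unique G G' :
  minimal_generating_set S G -> minimal_generating_set S G' -> G = G'.
Proof.
move=> minG minG'; apply/seteqP; split.
- by case: minG' => _ genG' _; exact: minimal_generating_set_sub.
- by case: minG => _ genG _; exact: minimal_generating_set_sub.
Qed.

End Uniqueness.
End Compositions.

Lemma horner_inj (K : numDomainType) (p q : {poly K}) :
  horner p =1 horner q -> p = q.
Proof.
move=> pq; apply/eqP; rewrite -subr_eq0; apply/negP => /negP pq0.
(* In characteristic zero the integers below the size of [p - q] are distinct roots, one more than
   its degree allows. *)
have := @max_poly_roots K (p - q) [seq i%:R | i <- iota 0 (size (p - q))] pq0.
rewrite size_map size_iota ltnn => H; suff : false by []; apply: H.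
  by apply/allP => x _; rewrite /root !hornerE pq subrr.
by rewrite map_inj_uniq ?iota_uniq// => i j /eqP; rewrite eqr_nat => /eqP.
Qed.

Section PolynomialOrder.
Variable K : numFieldType.
Implicit Types p q : {poly K}.

Definition poly_lt p q := (size p < size q)%N ||
  ((size p == size q) && (`|lead_coef p| < `|lead_coef q|)).

Lemma poly_lt_irr p : ~~ poly_lt p p.
Proof. by rewrite /poly_lt ltnn ltxx andbF. Qed.

Lemma poly_lt_trans : transitive poly_lt.
Proof.
move=> q p r; rewrite /poly_lt.
case/orP=> [pq|/andP[/eqP-> pq]]; case/orP=> [qr|/andP[/eqP<- qr]].
- by rewrite (ltn_trans pq qr).
- by rewrite pq.
- by rewrite qr.
- by rewrite eqxx (lt_trans pq qr) orbT.
Qed.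

Lemma size_comp_polyS p q : (1 < size p)%N -> (1 < size q)%N ->
  size (p \Po q) = ((size p).-1 * (size q).-1).+1.
Proof.
move=> p1 q1; rewrite -size_comp_poly prednK// size_poly_gt0.
by rewrite -lead_coef_eq0 lead_coef_comp// mulf_neq0 ?expf_neq0// lead_coef_eq0
  -size_poly_gt0 ltnW.
Qed.

Definition expanding p := (1 < size p)%N /\ (size p = 2 -> 1 < `|lead_coef p|).

(** If [q] has degree at least 2, the degree grows; if [q] is affine, the leading coefficient of [p]
    is multiplied by that of [q] to the power deg p, which is positive. *)
Lemma poly_lt_compl p q : expanding p -> expanding q -> poly_lt p (p \Po q).
Proof.
move=> [p1 _] [q1 lq]; rewrite /poly_lt lead_coef_comp// size_comp_polyS//.
have p0 : p != 0 by rewrite -size_poly_gt0 ltnW.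
have [q2|q2] := eqVneq (size q) 2; last first.
  apply/orP; left.
  have : (1 < (size q).-1)%N by case: (size q) q1 q2 => [|[|[|]]].
  case: (size p) p1 => [|[|n]]// _ q3.
  by rewrite /= ltnS ltn_Pmulr.
rewrite q2 muln1 prednK ?size_poly_gt0// ltnn eqxx /=.
rewrite normrM normrX ltr_pMr ?normr_gt0 ?lead_coef_eq0//.
by rewrite exprn_egt1 ?lq// -lt0n -subn1 subn_gt0.
Qed.

Lemma poly_lt_compr p q : expanding p -> expanding q -> poly_lt q (p \Po q).
Proof.
move=> [p1 lp] [q1 _]; rewrite /poly_lt lead_coef_comp// size_comp_polyS//.
have q0 : q != 0 by rewrite -size_poly_gt0 ltnW.
have [p2|p2] := eqVneq (size p) 2; last first.
  apply/orP; left.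
  have : (1 < (size p).-1)%N by case: (size p) p1 p2 => [|[|[|]]].
  case: (size q) q1 => [|[|n]]// _ p3.
  by rewrite /= ltnS ltn_Pmull.
(* For affine [p] the leading coefficient of [q] enters with exponent 1 and is scaled by the slope
   of [p]. *)
rewrite p2 mul1n prednK ?size_poly_gt0// ltnn eqxx /= expr1.
by rewrite normrM ltr_pMl ?lp// normr_gt0 lead_coef_eq0.
Qed.

End PolynomialOrder.

Section PolynomialMaps.
Variable R : realType.
Implicit Types (p q r : {poly cplx R}) (f g h : sphere R -> sphere R).

Lemma poly_map_inj : injective (@poly_map R).
Proof.
by move=> p q pq; apply: horner_inj => z; have [] := congr1 (@^~ (Some z)) pq.
Qed.

Lemma poly_map_comp p q r :
  poly_map r = poly_map p \o poly_map q -> r = p \Po q.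
Proof.
move=> rpq; apply: horner_inj => z; rewrite horner_comp.
by have [] := congr1 (@^~ (Some z)) rpq.
Qed.

(** By injectivity of [poly_map] the witnesses are unique, so the order on polynomials transfers to
    maps without choosing representatives. *)
Definition map_lt f g :=
  exists p q, [/\ f = poly_map p, g = poly_map q & poly_lt p q].

Lemma map_lt_irr f : ~ map_lt f f.
Proof.
move=> [p [q [-> /poly_map_inj <-]]]; exact/negP/poly_lt_irr.
Qed.

Lemma map_lt_trans f g h : map_lt f g -> map_lt g h -> map_lt f h.
Proof.
move=> [p [q [-> -> pq]]] [q' [r [/poly_map_inj <- -> qr]]].
by exists p, r; split=> //; exact: poly_lt_trans qr.
Qed.

Lemma polynomial_semigroup_expanding (S : set (sphere R -> sphere R)) f :
  polynomial_semigroup S -> S f -> exists2 p, f = poly_map p & expanding p.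
Proof.
move=> [[_ nconst _] Spoly Sdeg1 _] Sf; have [p fp] := Spoly _ Sf.
exists p => //; split; last first.
  move=> p2; rewrite fp in Sf; have [a [b [pab a1]]] := Sdeg1 _ Sf p2.
  by rewrite /lead_coef p2 pab !coefE /= mulr1 addr0.
rewrite ltnNge; apply/negP => p1; apply: (nconst _ Sf).
(* When the size is at most 1, [poly_map] also sends infinity to the constant coefficient, so the
   map is constant on the whole sphere. *)
exists (Some p`_0) => -[z|]; rewrite fp /= ?ltnNge ?p1//.
by rewrite (size1_polyC p1) hornerC coefC.
Qed.

End PolynomialMaps.

Theorem proposition1p5 (R : realType) (S : set (sphere R -> sphere R))
    (polyS : polynomial_semigroup S) (fgS : finitely_generated S) :
  exists! G, minimal_generating_set S G.
Proof.
have [[_ _ Scomp] Spoly _ _] := polyS.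
have lt_comp f h : S f -> S h -> map_lt f (f \o h) /\ map_lt h (f \o h).
  (* Closure of [S] provides the polynomial [r] of the composite; comparing values at finite points
     then identifies it. *)
  move=> Sf Sh; have [r fhr] := Spoly _ (Scomp _ _ Sf Sh).
  have [p fp ep] := polynomial_semigroup_expanding polyS Sf.
  have [q hq eq] := polynomial_semigroup_expanding polyS Sh.
  have rpq : r = p \Po q by apply: poly_map_comp; rewrite -fhr fp hq.
  split; [exists p, r|exists q, r]; split=> //; rewrite rpq.
  - exact: poly_lt_compl.
  - exact: poly_lt_compr.
have [G minG] := ex_minimal_generating_set fgS.
exists G; split=> // G'; apply: (minimal_generating_set_unique (lt := @map_lt R)) minG => //.
- exact: map_lt_irr.
- exact: map_lt_trans.
- by move=> f h Sf Sh; have [] := lt_comp f h Sf Sh.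
- by move=> f h Sf Sh; have [] := lt_comp f h Sf Sh.
Qed.
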